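(* Let $F,T:[0,1]\to\mathcal{K}(\mathbb{R})$ be set-valued Lipschitz maps with Lipschitz constant $l$. Then $\dim_H(\mathcal{G}(FT))\le\dim_H(\mathcal{G}(T))$.
   Context: $\mathcal{K}(\mathbb{R})$ is the collection of nonempty compact subsets of $\mathbb{R}$, with the Hausdorff metric $H_d$. Lipschitz with constant $l$ means $H_d(F(u),F(w))\le l|u-w|$ for all $u,w$. The product is $(FT)(u)=F(u)T(u)$, where $YZ=\{yz:y\in Y,z\in Z\}$ for compact $Y,Z\subset\mathbb{R}$. The graph of $F$ is $\mathcal{G}(F)=\{(u,F(u)):u\in[0,1]\}\subset[0,1]\times\mathcal{K}(\mathbb{R})$ (pairs of a number and a compact set), with metric $D_{\mathcal{G}}((u,F(u)),(w,F(w)))=|u-w|+H_d(F(u),F(w))$; $\dim_H$ is the Hausdorff dimension with respect to $D_{\mathcal{G}}$. *)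

(* Defs.v *)
From HB Require Import structures.
From mathcomp Require Import all_boot all_order all_algebra.
From mathcomp Require Import all_classical all_reals all_analysis.

Set Implicit Arguments.
Unset Strict Implicit.
Unset Printing Implicit Defensive.

Import Order.TTheory GRing.Theory Num.Theory.
Import numFieldNormedType.Exports.

Local Open Scope classical_set_scope.
Local Open Scope ring_scope.

Record compacts (R : realType) := Compacts {
  compacts_set :> set R ;
  compacts_nonempty : compacts_set !=set0 ;
  compacts_compact : compact compacts_set }.

Lemma compacts_inj (R : realType) (Y Z : compacts R) :
  compacts_set Y = compacts_set Z -> Y = Z.
Proof.
case: Y Z => [Y Y0 cY] [Z Z0 cZ] /= YZ; subst Z.
by congr Compacts; exact: Prop_irrelevance.
Qed.

HB.instance Definition _ (R : realType) := gen_eqMixin (compacts R).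
HB.instance Definition _ (R : realType) := gen_choiceMixin (compacts R).

Section hausdorff_metric.
Context {R : realType}.
Implicit Types (Y Z W : compacts R) (y z : R).

Definition point_dist (y : R) (Z : set R) : R := inf [set `|y - z| | z in Z].

Definition excess (Y Z : set R) : R := sup [set point_dist y Z | y in Y].

(* Real-valued sup and inf only see nonempty bounded sets here, since Y and Z
   are nonempty and compact. *)
Definition hausdorff_dist (Y Z : compacts R) : R :=
  Num.max (excess Y Z) (excess Z Y).

Let has_inf_dist y Z : has_inf [set `|y - z| | z in Z].
Proof.
split; last by exists 0 => _ [z _ <-].
by have [z Zz] := compacts_nonempty Z; exists `|y - z|; exists z.
Qed.

Lemma point_dist_ge0 y Z : 0 <= point_dist y Z.
Proof.
by apply: lb_le_inf; [exact: (has_inf_dist y Z).1|move=> _ [z _ <-]].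
Qed.

Lemma point_dist_le y z Z : compacts_set Z z -> point_dist y Z <= `|y - z|.
Proof. by move=> Zz; apply: ge_inf; [exact: (has_inf_dist y Z).2|exists z]. Qed.

Lemma point_dist_adherent y Z (e : R) : 0 < e ->
  exists2 z, compacts_set Z z & `|y - z| < point_dist y Z + e.
Proof.
by move=> e0; have [_ [z Zz <-] ?] := inf_adherent e0 (has_inf_dist y Z); exists z.
Qed.

Let has_sup_excess Y Z : has_sup [set point_dist y Z | y in Y].
Proof.
have [y0 Yy0] := compacts_nonempty Y; have [z0 Zz0] := compacts_nonempty Z.
split; first by exists (point_dist y0 Z); exists y0.
have [M [_ MY]] := compact_bounded (@compacts_compact _ Y).
exists (M + 1 + `|z0|) => _ [y Yy <-].
rewrite (le_trans (point_dist_le y Zz0))// (le_trans (ler_normB _ _))// lerD2r.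
by apply: MY => //; rewrite ltrDl.
Qed.

Lemma point_dist_excess y Y Z : compacts_set Y y -> point_dist y Z <= excess Y Z.
Proof. by move=> Yy; apply: ub_le_sup; [exact: (has_sup_excess Y Z).2|exists y]. Qed.

Lemma excess_le Y Z (r : R) : (forall y, compacts_set Y y -> point_dist y Z <= r) ->
  excess Y Z <= r.
Proof.
by move=> Yr; apply: ge_sup; [exact: (has_sup_excess Y Z).1|move=> _ [y Yy <-]; exact: Yr].
Qed.

Lemma excess_triangle Z Y W : excess Y W <= excess Y Z + excess Z W.
Proof.
apply: excess_le => y Yy; apply/ler_addgt0Pl => e e0.
have e20 : 0 < e / 2 by rewrite divr_gt0.
have [z Zz yz] := point_dist_adherent y Z e20.
have [w Ww zw] := point_dist_adherent z W e20.
rewrite (le_trans (point_dist_le y Ww))// (le_trans (ler_distD z _ _))//.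
rewrite (le_trans (lerD (ltW yz) (ltW zw)))// addrACA -splitr addrC lerD2l.
by apply: lerD; exact: point_dist_excess.
Qed.

Lemma excess_ge0 Y Z : 0 <= excess Y Z.
Proof.
have [y Yy] := compacts_nonempty Y.
by rewrite (le_trans (point_dist_ge0 y Z))// point_dist_excess.
Qed.

Lemma excess_eq0 Y Z : excess Y Z <= 0 -> Y `<=` Z.
Proof.
move=> YZ y Yy.
have cZ : closed Z := compact_closed (@Rhausdorff R) (@compacts_compact _ Z).
apply: cZ => B /nbhs_ballP[e /= e0 eB].
have [z Zz yz] := point_dist_adherent y Z e0; exists z; split => //.
apply: eB; rewrite /ball/= (lt_le_trans yz)// gerDr.
by rewrite (le_trans _ YZ)// point_dist_excess.
Qed.

Let hausdorff_distxx Y : hausdorff_dist Y Y = 0.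
Proof.
rewrite /hausdorff_dist maxxx; apply/eqP; rewrite eq_le excess_ge0 andbT.
by apply: excess_le => y Yy; rewrite (le_trans (point_dist_le y Yy))// subrr normr0.
Qed.

Let hausdorff_dist_positivity Y Z : hausdorff_dist Y Z = 0 -> Y = Z.
Proof.
move=> /eqP; rewrite eq_le ge_max => /andP[/andP[YZ ZY] _].
by apply: compacts_inj; apply/seteqP; split; exact: excess_eq0.
Qed.

Let hausdorff_dist_sym Y Z : hausdorff_dist Y Z = hausdorff_dist Z Y.
Proof. by rewrite /hausdorff_dist maxC. Qed.

Let hausdorff_dist_triangle Z Y W :
  hausdorff_dist Y W <= hausdorff_dist Y Z + hausdorff_dist Z W.
Proof.
rewrite {1}/hausdorff_dist ge_max; apply/andP; split.
  by rewrite (le_trans (excess_triangle Z Y W))// lerD// le_max lexx.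
rewrite (le_trans (excess_triangle Z W Y))// addrC.
by rewrite lerD// le_max lexx orbT.
Qed.

HB.instance Definition _ := isMetric.Build R (compacts R)
  hausdorff_distxx hausdorff_dist_positivity hausdorff_dist_sym
  hausdorff_dist_triangle.

End hausdorff_metric.

Section product.
Context {R : realType}.

Definition mul_set (Y Z : set R) : set R := [set y * z | y in Y & z in Z].

Lemma mul_set_nonempty (Y Z : compacts R) : mul_set Y Z !=set0.
Proof.
have [y Yy] := compacts_nonempty Y; have [z Zz] := compacts_nonempty Z.
by exists (y * z); exists y => //; exists z.
Qed.

Lemma mul_set_compact (Y Z : compacts R) : compact (mul_set Y Z).
Proof.
have -> : mul_set Y Z = (fun p : R * R => p.1 * p.2) @` (Y `*` Z).
  apply/seteqP; split => [_ [y Yy [z Zz <-]]|_ [[y z] [/= Yy Zz] <-]].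
    by exists (y, z).
  by exists y => //; exists z.
apply: continuous_compact.
  by apply: continuous_subspaceT => p; exact: mul_continuous.
by apply: compact_setX; exact: compacts_compact.
Qed.

Definition mul_compacts (Y Z : compacts R) : compacts R :=
  Compacts (mul_set_nonempty Y Z) (@mul_set_compact Y Z).

End product.

Definition unit_itv (R : realType) : set R := `[0, 1].
Arguments unit_itv R : clear implicits.

Section set_valued_maps.
Context {R : realType}.
Implicit Types F T : unit_itv R -> compacts R.

Definition mul_map F T : unit_itv R -> compacts R :=
  fun u => mul_compacts (F u) (T u).

Definition lipschitz_with (l : R) F :=
  forall u w : unit_itv R, mdist (F u) (F w) <= l * `|val u - val w|.

End set_valued_maps.

(* An alias of the product type, so that the sum metric below does not compete
   with the canonical (max) pseudometric of the library on products. *)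
Definition graph_space (R : realType) : Type := (unit_itv R * compacts R)%type.

HB.instance Definition _ (R : realType) := Choice.on (graph_space R).

Section graph_metric.
Context {R : realType}.
Implicit Types p q r : graph_space R.

Definition graph_dist p q : R := `|val p.1 - val q.1| + mdist p.2 q.2.

Let graph_distxx p : graph_dist p p = 0.
Proof. by rewrite /graph_dist subrr normr0 mdistxx addr0. Qed.

Let graph_dist_positivity p q : graph_dist p q = 0 -> p = q.
Proof.
case: p q => [u Y] [w Z] /eqP; rewrite paddr_eq0 ?mdist_ge0//=.
rewrite normr_eq0 subr_eq0 => /andP[/eqP/val_inj -> /eqP YZ].
by rewrite (mdist_positivity _ _ YZ).
Qed.

Let graph_dist_sym p q : graph_dist p q = graph_dist q p.
Proof. by rewrite /graph_dist distrC metric_sym. Qed.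

Let graph_dist_triangle q p r : graph_dist p r <= graph_dist p q + graph_dist q r.
Proof. by rewrite /graph_dist addrACA lerD ?ler_distD ?metric_triangle. Qed.

HB.instance Definition _ := isMetric.Build R (graph_space R)
  graph_distxx graph_dist_positivity graph_dist_sym graph_dist_triangle.

End graph_metric.

Definition graph {R : realType} (F : unit_itv R -> compacts R) :
  set (graph_space R) := range (fun u => (u, F u) : graph_space R).

Section hausdorff_dimension.
Context {R : realType} {T : metricType R}.
Implicit Types (A U : set T) (s delta : R).
Local Open Scope ereal_scope.

(* The maximum with 0 only matters for set0, whose supremum is -oo. *)
Definition diam U : \bar R :=
  maxe 0 (ereal_sup [set (mdist x y)%:E | x in U & y in U]).

(* In the library 0 `^ 0 = 1, so diam U `^ s alone would charge 1 to the empty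
   set when s = 0. *)
Definition diam_pow s U : \bar R :=
  if U == set0 then 0 else diam U `^ s.

Definition fine_cover delta A (U : nat -> set T) : Prop :=
  A `<=` \bigcup_n U n /\ forall n, diam (U n) <= delta%:E.

Definition hausdorff_premeasure s delta A : \bar R :=
  ereal_inf [set \sum_(0 <= n <oo) diam_pow s (U n) | U in fine_cover delta A].

Definition hausdorff_measure s A : \bar R :=
  ereal_sup [set hausdorff_premeasure s delta A |
    delta in [set delta | (0 < delta)%R]].

Definition hausdorff_dim A : \bar R :=
  ereal_inf [set s%:E |
    s in [set s | (0 <= s)%R /\ hausdorff_measure s A = 0]].

End hausdorff_dimension.

(* Main.v *)
Require Import Defs.
From mathcomp Require Import all_boot all_order all_algebra.
From mathcomp Require Import all_classical all_reals all_analysis.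
From mathcomp Require Import ring lra.

(** The map [(u, T u) |-> (u, F u T u)] from the graph of [T] onto the graph
    of [F T] is Lipschitz, and a Lipschitz map cannot raise the Hausdorff
    dimension.

    The second fact, [hausdorff_dim_image_le], holds between any two metric
    spaces: if the map is [c]-Lipschitz, the images of the pieces of a cover
    have diameters at most [c] times larger, so the [s]-sums of diameters grow
    at most by the factor [c `^ s], and every [s]-dimensional measure that
    vanishes on a set vanishes on its image.

    For the first one, the product is Lipschitz on bounded sets: if the elements
    of [Y] and [Y'] are bounded by [M] and those of [Z] and [Z'] by [N], then
    [H_d (Y Z) (Y' Z') <= M * H_d Z Z' + N * H_d Y Y'] ([mdist_mul_le]), because
    [y z - y' z' = y (z - z') + z' (y - y')].  A Lipschitz map on the unit
    interval has all its values inside one bounded set ([lipschitz_bounded]),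
    so that [H_d (F u T u) (F w T w)] is at most
    [M * H_d (T u) (T w) + N * |l| * |u - w|], hence at most a constant times
    the distance of [(u, T u)] and [(w, T w)] in the graph of [T]. *)

Set Implicit Arguments.
Unset Strict Implicit.
Unset Printing Implicit Defensive.

Import Order.TTheory GRing.Theory Num.Theory.
Import numFieldNormedType.Exports.

Local Open Scope classical_set_scope.
Local Open Scope ring_scope.

(** * Hausdorff dimension of a Lipschitz image *)

Section diameters.
Context {R : realType} {X : metricType R}.
Implicit Types U V : set X.
Local Open Scope ereal_scope.

Lemma diam_ge0 V : 0 <= diam V.
Proof. by rewrite /diam le_max lexx. Qed.

Lemma diam_pow_ge0 s V : 0 <= diam_pow s V.
Proof. by rewrite /diam_pow; case: ifP => // _; exact: poweR_ge0. Qed.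

Lemma diam_subset U V : U `<=` V -> diam U <= diam V.
Proof.
move=> UV; rewrite /diam ge_max le_max lexx/= le_max; apply/orP; right.
apply: ereal_sup_le => _ [x Ux [y Uy <-]].
by exists x; [exact: UV | exists y; [exact: UV |]].
Qed.

Lemma hausdorff_premeasure_ge0 s delta V : 0 <= hausdorff_premeasure s delta V.
Proof.
apply: le_ereal_inf_tmp => _ [U _ <-].
by apply: nneseries_ge0 => n _ _; exact: diam_pow_ge0.
Qed.

End diameters.

Section lipschitz_image.
Context {R : realType} {X Y : metricType R}.
Context (A : set X) (g : X -> Y) (c : R) (c_gt0 : 0 < c).
Context (g_lip :
  forall x y, A x -> A y -> mdist (g x) (g y) <= c * mdist x y).
Local Open Scope ereal_scope.

Lemma diam_image_le (V : set X) : V `<=` A -> diam (g @` V) <= c%:E * diam V.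
Proof.
move=> VA; rewrite {1}/diam ge_max; apply/andP; split.
  by rewrite mule_ge0 ?diam_ge0// lee_fin ltW.
apply: ge_ereal_sup => _ [_ [x Vx <-]] [_ [y Vy <-]] <-.
apply: (@le_trans _ _ (c%:E * (mdist x y)%:E)).
  by rewrite -EFinM lee_fin; apply: g_lip; exact: VA.
apply: lee_wpmul2l; first by rewrite lee_fin ltW.
rewrite /diam le_max; apply/orP; right.
by apply: ereal_sup_ubound; exists x => //; exists y.
Qed.

(** The piece [V] of a cover may leave [A], so the image is taken of a part [U]
    of it inside [A].  For [s = 0], where [diam V `^ s = 1], the estimate rests
    on an empty [V] having an empty image. *)
Lemma diam_pow_image_le (s : R) (U V : set X) : (0 <= s)%R ->
  U `<=` A -> U `<=` V -> diam_pow s (g @` U) <= (c `^ s)%:E * diam_pow s V.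
Proof.
move=> s0 UA UV; rewrite {1}/diam_pow; case: ifPn => [_|gU0].
  by rewrite mule_ge0 ?diam_pow_ge0// lee_fin powR_ge0.
have V0 : V != set0.
  move/set0P: gU0 => [_ [x Ux _]].
  by apply/set0P; exists x; exact: UV.
rewrite /diam_pow (negbTE V0) -poweR_EFin.
rewrite -poweRM ?diam_ge0 ?lee_fin ?(ltW c_gt0)//.
apply: (gt0_ler_poweR s0).
- by rewrite in_itv/= leey andbT /diam le_max lexx.
- by rewrite in_itv/= leey andbT mule_ge0 ?diam_ge0// lee_fin ltW.
- apply: le_trans (diam_image_le UA) _.
  by rewrite lee_wpmul2l ?diam_subset// lee_fin ltW.
Qed.

(** A cover of [A] at scale [delta / c] has images at scale [delta]. *)
Lemma hausdorff_premeasure_image_le (s delta : R) : (0 <= s)%R ->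
  hausdorff_premeasure s delta (g @` A) <=
  (c `^ s)%:E * hausdorff_premeasure s (delta / c) A.
Proof.
move=> s0; have cs0 : (0 < c `^ s)%R by rewrite powR_gt0.
rewrite -lee_pdivrMl//; apply: le_ereal_inf_tmp => _ [U [AU dU] <-].
rewrite lee_pdivrMl//.
(* The pieces are cut down to [A], because [g] is only controlled there. *)
apply: (@le_trans _ _
    (\sum_(0 <= n <oo) diam_pow s (g @` (U n `&` A)))).
  apply: ereal_inf_lbound; exists (fun n => g @` (U n `&` A)) => //; split.
    move=> _ [x Ax <-]; have [n _ Unx] := AU _ Ax.
    by exists n => //; exists x.
  move=> n; apply: le_trans (diam_image_le (@subIsetr _ _ _)) _.
  rewrite -lee_pdivlMl// -EFinM mulrC.
  by apply: le_trans (dU n); apply: diam_subset; exact: subIsetl.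
rewrite -nneseriesZl => [|n _]; last exact: diam_pow_ge0.
apply: lee_nneseries => [n _ _|n _]; first exact: diam_pow_ge0.
exact: diam_pow_image_le.
Qed.

Lemma hausdorff_measure_image_eq0 (s : R) : (0 <= s)%R ->
  hausdorff_measure s A = 0 -> hausdorff_measure s (g @` A) = 0.
Proof.
move=> s0 sA0; apply/eqP; rewrite eq_le; apply/andP; split.
  apply: ge_ereal_sup => _ [delta /= delta0 <-].
  apply: le_trans (hausdorff_premeasure_image_le _ s0) _.
  rewrite mule_ge0_le0 ?lee_fin ?powR_ge0// -sA0.
  by apply: ereal_sup_ubound; exists (delta / c)%R => //=; exact: divr_gt0.
apply: (le_trans (hausdorff_premeasure_ge0 s 1%R (g @` A))).
by apply: ereal_sup_ubound; exists 1%R => //=.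
Qed.

Lemma hausdorff_dim_image_le : hausdorff_dim (g @` A) <= hausdorff_dim A.
Proof.
apply: ereal_inf_le_tmp => _ [s [s0 sA0] <-]; exists s => //; split => //.
exact: hausdorff_measure_image_eq0.
Qed.

End lipschitz_image.

(** * The product of bounded compact sets *)

Section product_lipschitz.
Context {R : realType}.
Implicit Types (Y Z : compacts R) (M N l : R).

Lemma compacts_bounded Y :
  exists2 M, 0 <= M & forall y, compacts_set Y y -> `|y| <= M.
Proof.
have [M [_ MY]] := compact_bounded (@compacts_compact _ Y).
exists (`|M| + 1); first by rewrite addr_ge0.
by move=> y Yy; apply: MY => //; rewrite ltr_pwDr// ler_norm.
Qed.

Lemma excess_le_mdist Y Z : excess Y Z <= mdist Y Z.
Proof. by rewrite /mdist/= /hausdorff_dist le_max lexx. Qed.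

Lemma excess_mul_le Y Y' Z Z' M N : 0 <= M -> 0 <= N ->
  (forall y, compacts_set Y y -> `|y| <= M) ->
  (forall z, compacts_set Z' z -> `|z| <= N) ->
  excess (mul_set Y Z) (mul_set Y' Z') <= M * mdist Z Z' + N * mdist Y Y'.
Proof.
move=> M0 N0 YM ZN.
apply: (@excess_le _ (mul_compacts Y Z) (mul_compacts Y' Z')).
move=> _ [y Yy [z Zz <-]]; apply/ler_addgt0Pl => e e0.
(* Choosing [y'] and [z'] up to [d] from optimal costs [(M + N) * d], below
   [e]; the [1] only keeps the denominator nonzero. *)
pose d := e / (M + N + 1).
have MN1 : 0 < M + N + 1 by lra.
have d0 : 0 < d by rewrite divr_gt0.
have dE : d * (M + N + 1) = e by rewrite divfK ?gt_eqF.
have [y' Yy' yy'] := point_dist_adherent y Y' d0.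
have [z' Zz' zz'] := point_dist_adherent z Z' d0.
have {}yy' : `|y - y'| <= mdist Y Y' + d.
  apply: le_trans (ltW yy') _; rewrite lerD2r.
  exact: le_trans (point_dist_excess Y' Yy) (excess_le_mdist _ _).
have {}zz' : `|z - z'| <= mdist Z Z' + d.
  apply: le_trans (ltW zz') _; rewrite lerD2r.
  exact: le_trans (point_dist_excess Z' Zz) (excess_le_mdist _ _).
have yz' : compacts_set (mul_compacts Y' Z') (y' * z').
  by exists y' => //; exists z'.
apply: le_trans (point_dist_le (y * z) yz') _.
have -> : y * z - y' * z' = y * (z - z') + z' * (y - y') by ring.
apply: le_trans (ler_normD _ _) _; rewrite !normrM.
have H1 : `|y| * `|z - z'| <= M * (mdist Z Z' + d) by rewrite ler_pM ?YM.
have H2 : `|z'| * `|y - y'| <= N * (mdist Y Y' + d) by rewrite ler_pM ?ZN.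
lra.
Qed.

(** The bounds are asked of both pairs of sets, since the Hausdorff distance
    combines the two one-sided excesses. *)
Lemma mdist_mul_le Y Y' Z Z' M N : 0 <= M -> 0 <= N ->
  (forall y, compacts_set Y y -> `|y| <= M) ->
  (forall y, compacts_set Y' y -> `|y| <= M) ->
  (forall z, compacts_set Z z -> `|z| <= N) ->
  (forall z, compacts_set Z' z -> `|z| <= N) ->
  mdist (mul_compacts Y Z) (mul_compacts Y' Z') <=
  M * mdist Z Z' + N * mdist Y Y'.
Proof.
move=> M0 N0 YM Y'M ZN Z'N.
rewrite {1}/mdist/= /hausdorff_dist ge_max excess_mul_le//=.
by rewrite (metric_sym Z) (metric_sym Y) excess_mul_le.
Qed.

Lemma lipschitz_mdist_le l (F : unit_itv R -> compacts R) : lipschitz_with l F ->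
  forall u w, mdist (F u) (F w) <= `|l| * `|val u - val w|.
Proof.
move=> Fl u w; apply: le_trans (Fl u w) _.
by rewrite ler_wpM2r ?ler_norm.
Qed.

(** The unit interval has diameter [1], so every point of every value of the map
    lies within [|l| + 1] of the compact value at [0]. *)
Lemma lipschitz_bounded l (F : unit_itv R -> compacts R) : lipschitz_with l F ->
  exists2 M, 0 <= M & forall u y, compacts_set (F u) y -> `|y| <= M.
Proof.
move=> Fl.
have itv0 : (0 : R) \in unit_itv R.
  by rewrite inE /unit_itv /= in_itv/= lexx ler01.
pose o : unit_itv R := SigSub itv0.
have [M0 M00 FM0] := compacts_bounded (F o).
exists (M0 + `|l| + 1); first by have := normr_ge0 l; lra.
move=> u y Fuy.
have [z Fz yz] := point_dist_adherent y (F o) (@ltr01 R).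
have dl : point_dist y (F o) <= `|l|.
  apply: le_trans (point_dist_excess (F o) Fuy) _.
  apply: le_trans (excess_le_mdist _ _) _.
  apply: le_trans (lipschitz_mdist_le Fl _ _) _.
  rewrite ler_piMr// subr0.
  have : val u \in unit_itv R by exact: valP.
  rewrite inE /unit_itv /= in_itv/= => /andP[u0 u1].
  by rewrite ger0_norm.
have -> : y = (y - z) + z by ring.
apply: le_trans (ler_normD _ _) _; have := FM0 _ Fz; lra.
Qed.

End product_lipschitz.

(** * Graphs of set-valued maps *)

Theorem lemma5p16 (R : realType) (l : R) (F T : unit_itv R -> compacts R) :
  lipschitz_with l F -> lipschitz_with l T ->
  (hausdorff_dim (graph (mul_map F T)) <= hausdorff_dim (graph T))%E.
Proof.
move=> Fl Tl.
have [M M0 FM] := lipschitz_bounded Fl.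
have [N N0 TN] := lipschitz_bounded Tl.
pose g (p : graph_space R) : graph_space R := (p.1, mul_map F T p.1).
have -> : graph (mul_map F T) = g @` graph T.
  apply/seteqP; split => [_ [u _ <-]|_ [_ [u _ <-] <-]].
    by exists (u, T u) => //; exists u.
  by exists u.
have Nl0 : 0 <= N * `|l| by rewrite mulr_ge0.
(* In the Lipschitz constant, [1] comes from the unchanged first coordinate,
   [M] from the variation of [T] and [N * `|l|] from the variation of [F]. *)
apply: (@hausdorff_dim_image_le _ _ _ _ _ (1 + M + N * `|l|)); first lra.
move=> _ _ [u _ <-] [w _ <-].
rewrite /mdist/= /graph_dist/=.
have FTuw := mdist_mul_le M0 N0 (FM u) (FM w) (TN u) (TN w).
have Fuw : N * mdist (F u) (F w) <= N * `|l| * `|val u - val w|.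
  by rewrite -mulrA ler_wpM2l// lipschitz_mdist_le.
rewrite /mul_map.
have d0 : 0 <= `|val u - val w| by [].
have T0 : 0 <= mdist (T u) (T w) by exact: mdist_ge0.
apply: le_trans (lerD (lexx _) FTuw) _.
nra.
Qed.
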